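(* Let $(\mathcal V,\|\cdot\|_{\star})$ be a normed space and let $\mathcal{DD}:\mathcal V\to\mathcal V$ be a (not necessarily linear) contraction with constant $q\in[0,1)$, that is, \[ \|\mathcal{DD}(v)-\mathcal{DD}(w)\|_{\star}\leq q\,\|v-w\|_{\star}\qquad\forall v,w\in\mathcal V. \] Assume that $u\in\mathcal V$ is the unique fixed point of $\mathcal{DD}$, namely $u=\mathcal{DD}(u)$. Let $C_{\mathrm{DD}}>0$ and $\varepsilon\geq 0$ be real constants. Let $(\widetilde u^{(k)})_{k\geq 0}$ be a sequence in $\mathcal V$ satisfying \[ \widetilde u^{(k+1)}=\mathcal{DD}(\widetilde u^{(k)})+\delta^{(k)},\qquad k\geq 0, \] where $\widetilde u^{(0)}\in\mathcal V$ is arbitrary and the perturbations $\delta^{(k)}\in\mathcal V$ satisfy \[ \|\delta^{(k)}\|_{\star}\leq C_{\mathrm{DD}}\,\varepsilon\qquad\forall k\geq 0. \] Then, for every $k\geq 0$, \[ \|u-\widetilde u^{(k)}\|_{\star}\leq q^k\,\|u-\widetilde u^{(0)}\|_{\star}+\frac{1-q^k}{1-q}\,C_{\mathrm{DD}}\,\varepsilon . \] In particular, \[ \limsup_{k\to\infty}\|u-\widetilde u^{(k)}\|_{\star}\leq\frac{C_{\mathrm{DD}}}{1-q}\,\varepsilon . \]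
   Context: $\mathcal{DD}$ plays the role of the iteration operator of an exact domain decomposition solver, and $\delta^{(k)}$ is the perturbation produced at iteration $k$ when the exact local solvers are replaced by surrogates; $\varepsilon$ is a uniform bound on the surrogate error and $C_{\mathrm{DD}}$ is a stability constant. The statement uses only the abstract properties listed in the claim. The convention $q^0=1$ is used (also when $q=0$). *)

(* Defs.v *)
From mathcomp Require Export all_boot all_order all_algebra.
From mathcomp Require Export all_classical all_reals all_analysis.

(* Main.v *)
Require Import Defs.
From mathcomp Require Import all_boot all_order all_algebra.
From mathcomp Require Import all_classical all_reals all_analysis.
From mathcomp Require Import ring.
Import Order.TTheory GRing.Theory Num.Theory.
Import numFieldNormedType.Exports.
Local Open Scope classical_set_scope.
Local Open Scope ring_scope.

(** Since [u] is fixed, one step contracts the error by [q] and adds at most [CDD * eps]; iterating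
    this recursion sums a geometric series. For the limsup, the transient [q ^+ k * |u - ut 0|]
    tends to 0 and the partial sums stay below [1 / (1 - q)]. *)

Theorem proposition1 (R : realType) (V : normedModType R) (DD : V -> V) (q : R)
    (hq0 : 0 <= q) (hq1 : q < 1)
    (hDD : forall v w : V, `|DD v - DD w| <= q * `|v - w|)
    (u : V) (hu : u = DD u) (hu_unique : forall v : V, v = DD v -> v = u)
    (CDD eps : R) (hC : 0 < CDD) (heps : 0 <= eps)
    (ut delta : nat -> V)
    (hut : forall k : nat, ut k.+1 = DD (ut k) + delta k)
    (hdelta : forall k : nat, `|delta k| <= CDD * eps) :
  (forall k : nat,
     `|u - ut k| <=
       q ^+ k * `|u - ut 0%N| + (1 - q ^+ k) / (1 - q) * CDD * eps) /\
  (limn_esup (fun k : nat => `|u - ut k|%:E) <= (CDD / (1 - q) * eps)%:E)%E.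
Proof.
have q1 : 0 < 1 - q by rewrite subr_gt0.
have bound k : `|u - ut k| <=
    q ^+ k * `|u - ut 0%N| + (1 - q ^+ k) / (1 - q) * CDD * eps.
  elim: k => [|k IH]; first by rewrite expr0 mul1r subrr !mul0r addr0.
  rewrite hut {1}hu opprD addrA.
  apply: (le_trans (ler_normB _ _)).
  apply: (le_trans (lerD (le_trans (hDD _ _) (ler_wpM2l hq0 IH)) (hdelta k))).
  (* The two sides are equal: [q * (1 - q ^+ k) / (1 - q) + 1 = (1 - q ^+ k.+1) / (1 - q)]. *)
  rewrite le_eqVlt; apply/orP; left; apply/eqP; rewrite exprS; field.
  exact: lt0r_neq0.
split=> //; apply/lee_addgt0Pr => e e0.
(* Bound the limsup by the supremum over the tail where the transient
   q^k |u - ut 0| is at most e. *)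
have qk0 : (fun k => q ^+ k * `|u - ut 0%N|) @ \oo --> (0 : R).
  rewrite -(mul0r `|u - ut 0%N|); apply: cvgMr_tmp.
  by apply: cvg_expr; rewrite ger0_norm.
have tail : \forall k \near \oo, q ^+ k * `|u - ut 0%N| <= e.
  exact: (cvgr_le 0 qk0).
(* [limn_esup] is an infimum over all members of the filter [\oo], so the set from [tail] serves
   without an explicit rank. *)
apply: le_trans (ereal_inf_lbound _) _.
  by exists [set k | q ^+ k * `|u - ut 0%N| <= e].
apply: ge_ereal_sup => _ /= [k tk <-].
rewrite -EFinD lee_fin [leRHS]addrC; apply: (le_trans (bound k)); apply: lerD => //.
have Ce : 0 <= CDD * eps by rewrite mulr_ge0 // ltW.
(* Isolates the nonnegative gap between the partial sum and its limit, which is then dropped. *)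
have -> : (1 - q ^+ k) / (1 - q) * CDD * eps
  = CDD / (1 - q) * eps - q ^+ k * (CDD * eps / (1 - q)).
  by field; exact: lt0r_neq0.
by rewrite gerBl mulr_ge0 ?exprn_ge0 ?divr_ge0 // ltW.
Qed.
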